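(* Let $G$ be a group acting with only finitely many orbits and almost freely on a connected two-ended graph $\Gamma$ without dominated ends. Then $G$ contains an infinite cyclic subgroup of finite index.
   Context: Groups act on graphs by automorphisms, and orbits are orbits on the vertex set. The action is almost free if the stabilizer of every vertex is finite. Graphs are not assumed locally finite. A ray is a one-way infinite path; an end is an equivalence class of rays, two rays being equivalent if there is no finite vertex set $S$ such that they have tails in different components of $\Gamma\setminus S$; two-ended means having exactly two ends. For a finite vertex set $S$ and an end $\omega$, $C(S,\omega)$ denotes the component of $\Gamma\setminus S$ containing tails of the rays of $\omega$. A vertex $v$ dominates an end $\omega$ if there is no finite vertex set $S$ not containing $v$ with $v\notin C(S,\omega)$; an end is dominated if some vertex dominates it. *)

(* Defs.v *)
From mathcomp Require Import all_boot.
From mathcomp Require Import boolp classical_sets functions cardinality.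
From Stdlib Require Import Relation_Operators.

Set Implicit Arguments.
Unset Strict Implicit.
Unset Printing Implicit Defensive.

Local Open Scope classical_set_scope.

(* Graphs are simple: undirected, without loops or multiple edges, on a vertex
   set of arbitrary cardinality and with no restriction on vertex degrees. *)
Record graph := Graph {
  vertex :> Type;
  adj : vertex -> vertex -> Prop;
  adj_sym : forall x y, adj x y -> adj y x;
  adj_irr : forall x, ~ adj x x
}.

Section Graphs.
Variable Gamma : graph.
Implicit Types (S C : set Gamma) (r : nat -> Gamma) (w : set (nat -> Gamma)).

Definition adj_minus S (x y : Gamma) : Prop := [/\ adj x y, ~ S x & ~ S y].

(* Meaningful for x outside S: then y is outside S as well. *)
Definition linked_minus S : Gamma -> Gamma -> Prop :=
  clos_refl_trans Gamma (adj_minus S).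

Definition connected_graph : Prop := forall x y : Gamma, linked_minus set0 x y.

Definition is_component S C : Prop :=
  exists2 x, ~ S x & C = [set y | linked_minus S x y].

Definition is_ray r : Prop := injective r /\ forall n, adj (r n) (r n.+1).

Definition tail_in r C : Prop := exists n, forall k, (n <= k)%N -> C (r k).

Definition ray_equiv r1 r2 : Prop :=
  ~ exists S C1 C2,
      [/\ finite_set S, is_component S C1, is_component S C2, C1 <> C2 &
          tail_in r1 C1 /\ tail_in r2 C2].

Definition ray_class r : set (nat -> Gamma) :=
  [set r' | is_ray r' /\ ray_equiv r r'].

Definition ends : set (set (nat -> Gamma)) :=
  [set ray_class r | r in [set r | is_ray r]].

Definition two_ended : Prop := exists w1 w2, w1 <> w2 /\ ends = [set w1; w2].

(* C(S, w), as the union of all components of Gamma minus S that contain a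
   tail of every ray of w; for S finite and w an end there is exactly one. *)
Definition end_component S w : set Gamma :=
  [set v | exists C,
     [/\ is_component S C, (forall r, w r -> tail_in r C) & C v]].

Definition dominates (v : Gamma) w : Prop :=
  ~ exists S, [/\ finite_set S, ~ S v & ~ end_component S w v].

Definition dominated w : Prop := exists v, dominates v w.

End Graphs.

Arguments ends : clear implicits.
Arguments two_ended : clear implicits.
Arguments connected_graph : clear implicits.

Record graph_action (G : groupType) (Gamma : graph) := GraphAction {
  act :> G -> Gamma -> Gamma;
  act1 : forall v, act 1%g v = v;
  actM : forall g h v, act (g * h)%g v = act g (act h v);
  act_adj : forall g x y, adj (act g x) (act g y) <-> adj x y
}.

Section Actions.
Variables (G : groupType) (Gamma : graph) (a : graph_action G Gamma).

Definition orbit_of (v : Gamma) : set Gamma := range (fun g => a g v).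

Definition finitely_many_orbits : Prop := finite_set (range orbit_of).

Definition stabilizer (v : Gamma) : set G := [set g | a g v = v].

Definition almost_free : Prop := forall v, finite_set (stabilizer v).

End Actions.

Section Subgroups.
Variable G : groupType.
Implicit Types (H : set G) (z : G).

Definition is_subgroup H : Prop :=
  [/\ H 1%g, (forall x y, H x -> H y -> H (x * y)%g) &
      (forall x, H x -> H (x^-1)%g)].

Definition is_cyclic H : Prop :=
  exists z, H = [set x | exists n : nat, x = (z ^+ n)%g \/ x = (z ^- n)%g].

Definition left_coset H (g : G) : set G := [set (g * h)%g | h in H].

Definition finite_index H : Prop := finite_set (range (left_coset H)).

End Subgroups.

(* Main.v *)
Require Import Defs.
From mathcomp Require Import all_boot.
From mathcomp Require Import boolp classical_sets functions cardinality.
From Stdlib Require Import Relation_Operators.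

Set Implicit Arguments.
Unset Strict Implicit.
Unset Printing Implicit Defensive.

Local Open Scope classical_set_scope.

(** Let r1 and r2 be rays of the two ends, and let S be a finite connected vertex
set that leaves their tails in different components; write C(S, i) for the
component containing a tail of ri. Almost freeness is used in one form: for
finite F and S, only finitely many g move some vertex of F into S
([finite_hits]), so nearly every translate of S is as far away as desired.

The first step is that a finite connected set T leaves only finitely many
vertices outside C(T, 1) and C(T, 2) ([finite_sideless]). If there were
infinitely many, then infinitely many of them would lie in one orbit, so some
vertex x would be cut off from both ends by translates g^-1 T that are arbitrarily
far from x, from S and from long initial segments of r1 and r2. Such a translate
is connected and avoids S, so it misses C(S, 1) or C(S, 2), and then x
reaches the corresponding ray without meeting it ([far_set_side]).

The second step is to find a translation. Infinitely many g fix the end of r1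
([infinite_end_stabilizer]), hence both ends; choose one for which T = g^-1 S is
far from S. Then T lies in one of the components C(S, i), say i = 2, and S lies
in C(T, 1). It follows that A = C(S, 2) contains g^-1 A = C(T, 2), and by the
first step, applied to a finite connected set containing S and T, the difference
A minus g^-1 A is finite.

The third step is that this difference meets every orbit of the powers of g
([meets_domain]). The vertices lying in some g^m A form a set closed under
adjacency, because the boundary of g^m A lies in g^m S, hence in g^(m+1) A; the
same holds for the vertices lying outside some g^m A. By connectedness every
vertex has both properties, so it lies in g^m A minus g^(m-1) A for some integer
m. With finite stabilizers, the powers of g then have finite index, and the
strict nesting makes g of infinite order. *)

(** * Linking outside a set, and finite connected sets *)

Section Linking.
Variable Gamma : graph.
Implicit Types (S T F P : set Gamma) (x y z v : Gamma).

Lemma linked_trans S x y z :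
  linked_minus S x y -> linked_minus S y z -> linked_minus S x z.
Proof. exact: rt_trans. Qed.

Lemma linked_sym S x y : linked_minus S x y -> linked_minus S y x.
Proof.
elim=> [u v [uv Su Sv]|u|u v w _ uv _ vw]; last exact: linked_trans vw uv.
- by apply: rt_step; split=> //; exact: adj_sym.
- exact: rt_refl.
Qed.

Lemma linked_subset S T x y : S `<=` T -> linked_minus T x y -> linked_minus S x y.
Proof.
move=> ST; elim=> [u v [uv Tu Tv]|u|u v w _ uv _ vw].
- by apply: rt_step; split=> // /ST.
- exact: rt_refl.
- exact: linked_trans uv vw.
Qed.

Lemma linked_outside S x y : linked_minus S x y -> ~ S x -> ~ S y.
Proof. by elim=> [u v []|//|u v w _ uv _ vw /uv /vw]. Qed.

(** Removing a set that a component of the complement of [T] does not meet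
leaves the paths of that component intact. *)
Lemma linked_avoid S T x y :
  (forall z, linked_minus T x z -> ~ S z) ->
  linked_minus T x y -> linked_minus S x y.
Proof.
move=> noS xy; elim: xy noS => [u v uv|u|u v w uv IHuv vw IHvw] noS.
- case: (uv) => adjuv _ _; apply: rt_step; split=> //.
  + exact/noS/rt_refl.
  + exact/noS/rt_step.
- exact: rt_refl.
- apply: linked_trans (IHuv noS) (IHvw _) => z vz.
  exact: noS (linked_trans uv vz).
Qed.

(** Induction along paths: in a connected graph it is enough to propagate a
property along edges. *)
Lemma connected_closed P v0 : connected_graph Gamma ->
  P v0 -> (forall x y, adj x y -> P x -> P y) -> forall v, P v.
Proof.
move=> conG Pv0 Padj v; move: Pv0; elim: (conG v0 v) => [x y [xy _ _]|//|].
- exact: Padj.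
- by move=> x y z _ xy _ yz /xy /yz.
Qed.

(** Connectedness of the subgraph induced on [F]: paths avoid the complement. *)
Definition connected_set F := forall x y, F x -> F y -> linked_minus (~` F) x y.

Lemma connected_set_linked F S x y :
  connected_set F -> (forall z, F z -> ~ S z) -> F x -> F y -> linked_minus S x y.
Proof.
by move=> conF FS Fx Fy; apply: linked_subset (conF x y Fx Fy) => z Sz /FS.
Qed.

(** Degrees may be infinite, so balls need not be finite; a finite connected
set is obtained as a union of finitely many paths starting at [v0]. *)
Lemma finite_connected_hull v0 S : connected_graph Gamma -> finite_set S ->
  exists F, [/\ finite_set F, connected_set F, F v0 & S `<=` F].
Proof.
move=> conG finS.
have /choice[P PP] v : exists P,
    [/\ finite_set P, connected_set P, P v0 & P v].
  move: v; apply: (connected_closed (v0 := v0)) => //.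
    exists [set v0]; split=> // x y -> ->; exact: rt_refl.
  move=> x y xy [P [finP conP Pv0 Px]].
  exists (P `|` [set y]); split; [by rewrite finite_setU| |by left|by right].
  have toX z : (P `|` [set y]) z -> linked_minus (~` (P `|` [set y])) z x.
    case=> [Pz|->].
      by apply: connected_set_linked conP _ Pz Px => w Pw; apply; left.
    by apply: rt_step; split; [exact: adj_sym|apply; right|apply; left].
  by move=> u v /toX ux /toX vx; exact: linked_trans ux (linked_sym vx).
exists (\bigcup_(v in [set v0] `|` S) P v); split.
- by apply: bigcup_finite => [|v _]; [rewrite finite_setU|case: (PP v)].
- set U := \bigcup_(v in _) _ => u v.
  have toV0 z : U z -> linked_minus (~` U) z v0.
    move=> [w Sw Pwz]; have [_ conP Pw0 _] := PP w.
    by apply: connected_set_linked conP _ Pwz Pw0 => t Pwt; apply; exists w.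
  by move=> /toV0 u0 /toV0 v1; exact: linked_trans u0 (linked_sym v1).
- by exists v0; [left|case: (PP v0)].
- by move=> v Sv; exists v; [right|case: (PP v)].
Qed.

End Linking.

(** * The side of a finite set that contains a tail of a ray *)

Section Sides.
Variable Gamma : graph.
Implicit Types (S T F P : set Gamma) (x y z v : Gamma) (r : nat -> Gamma).

(** For a ray [r] and a finite set [T] this is the component C(T, r); describing
it by links to the tail of [r] makes it commute with automorphisms. *)
Definition side T r : set Gamma :=
  [set v | exists n, forall k, (n <= k)%N -> linked_minus T v (r k)].

(** A vertex of [T] is linked to itself only, whereas a ray visits infinitely
many vertices. *)
Lemma side_outside T r v : is_ray r -> side T r v -> ~ T v.
Proof.
move=> [injr _] [n vr] Tv.
have stuck k : (n <= k)%N -> r k = v.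
  move=> /vr /linked_sym vk; apply: contrapT => rkv.
  case: (pselect (T (r k))) => Trk; last exact: linked_outside vk Trk Tv.
  suff only x y : linked_minus T x y -> T x -> y = x.
    exact: rkv (esym (only _ _ vk Trk)).
  elim=> [a b [_ nTa _] /nTa//|//|a b c _ ab _ bc Ta].
  by have ba := ab Ta; rewrite bc ba.
have : r n = r n.+1 by rewrite !stuck.
by move/injr/eqP; rewrite ltn_eqF.
Qed.

Lemma side_linked T r v w : linked_minus T v w -> side T r w -> side T r v.
Proof.
by move=> vw [n wr]; exists n => k /wr; exact: linked_trans vw.
Qed.

Lemma side_common T r v w : side T r v -> side T r w -> linked_minus T v w.
Proof.
move=> [m vr] [n wr]; apply: (linked_trans (y := r (maxn m n))).
  exact/vr/leq_maxl.
exact/linked_sym/wr/leq_maxr.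
Qed.

Lemma side_subset S T r : S `<=` T -> side T r `<=` side S r.
Proof. by move=> ST v [n vr]; exists n => k /vr; exact: linked_subset ST. Qed.

(** This is how sides get nested: once the [T]-side of [r] does not meet [S],
it is connected outside [S] and so lies within the [S]-side of [r]. *)
Lemma side_avoid S T r v :
  (forall z, side T r z -> ~ S z) -> side T r v -> side S r v.
Proof.
move=> noS Tv; have [n vr] := Tv; exists n => k /vr; apply: linked_avoid => z vz.
exact/noS/(side_linked (linked_sym vz) Tv).
Qed.

Lemma finite_nat_bounded (A : set nat) : finite_set A ->
  exists n, forall k, (n <= k)%N -> ~ A k.
Proof.
move=> /finite_seqP[s ->]; exists (\max_(i <- s) i).+1 => k nk /= ks.
by move: nk; rewrite ltnNge (leq_bigmax_seq k).
Qed.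

Lemma ray_leaves T r : is_ray r -> finite_set T ->
  exists n, forall k, (n <= k)%N -> ~ T (r k).
Proof.
move=> [injr _] finT; apply: (finite_nat_bounded (A := r @^-1` T)).
by apply: finite_preimage finT => x y _ _; exact: injr.
Qed.

Lemma ray_linked T r n : is_ray r ->
  (forall k, (n <= k)%N -> ~ T (r k)) ->
  forall k, (n <= k)%N -> linked_minus T (r n) (r k).
Proof.
move=> [_ adjr] rT; elim=> [|k IHk]; first by rewrite leqn0 => /eqP ->; exact: rt_refl.
rewrite leq_eqVlt => /orP[/eqP ->|nk]; first exact: rt_refl.
apply: linked_trans (IHk nk) _; apply: rt_step; split; [exact: adjr|exact: rT|].
by apply: rT; exact: leqW.
Qed.

Lemma ray_in_side T r : is_ray r -> finite_set T -> tail_in r (side T r).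
Proof.
move=> rayr finT; have [n rT] := ray_leaves rayr finT; exists n => k nk; exists k.
by apply: ray_linked => // j kj; apply: rT; exact: leq_trans nk kj.
Qed.

Lemma side_component T r : is_ray r -> finite_set T -> is_component T (side T r).
Proof.
move=> rayr finT; have [n rT] := ray_in_side rayr finT.
have Trn := rT n (leqnn n).
exists (r n); first exact: side_outside Trn.
apply/seteqP; split=> v /=; first exact: side_common.
by move=> nv; exact: side_linked (linked_sym nv) Trn.
Qed.

(** Two components containing tails of the same ray meet, hence coincide; this
turns statements about components into statements about [side]. *)
Lemma component_side T r C :
  is_ray r -> finite_set T -> is_component T C -> tail_in r C -> C = side T r.
Proof.
move=> rayr finT [x _ ->] [n xr]; have [m rT] := ray_in_side rayr finT.
have xin : side T r x.
  exact: side_linked (xr _ (leq_maxl n m)) (rT _ (leq_maxr n m)).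
apply/seteqP; split=> v /=; last exact: side_common.
by move=> xv; exact: side_linked (linked_sym xv) xin.
Qed.

Definition same_end r r' := forall T, finite_set T -> side T r = side T r'.

Lemma ray_equivE r r' : is_ray r -> is_ray r' -> ray_equiv r r' <-> same_end r r'.
Proof.
move=> rayr rayr'; split=> [equiv T finT|same [S [C [C' [finS compC compC' ne]]]]].
  apply: contrapT => ne; apply: equiv; exists T, (side T r), (side T r'); split=> //.
  - exact: side_component.
  - exact: side_component.
  - by split; exact: ray_in_side.
move=> [rC rC']; apply: ne.
by rewrite (component_side rayr finS compC rC) (component_side rayr' finS compC' rC') same.
Qed.

Definition separates S r1 r2 := forall v, side S r1 v -> ~ side S r2 v.

Lemma not_same_end_separates r1 r2 : is_ray r1 -> is_ray r2 -> ~ same_end r1 r2 ->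
  exists2 S, finite_set S & separates S r1 r2.
Proof.
move=> ray1 ray2 diff; apply: contrapT => nosep; apply: diff => T finT.
apply: contrapT => ne; apply: nosep; exists T => // v v1 v2; apply: ne.
apply/seteqP; split=> w wi.
- exact: side_linked (side_common wi v1) v2.
- exact: side_linked (side_common wi v2) v1.
Qed.

(** Everything that is used of the two ends: two inequivalent rays, and the
fact that every ray is equivalent to one of them. *)
Lemma two_ended_rays : two_ended Gamma ->
  exists r1 r2, [/\ is_ray r1, is_ray r2, ~ same_end r1 r2 &
    forall r, is_ray r -> same_end r r1 \/ same_end r r2].
Proof.
move=> [w1 [w2 [ne endsE]]].
have class_self r : is_ray r -> ray_class r r by move=> rayr; split=> //; exact/ray_equivE.
have class_eq r r' : is_ray r -> is_ray r' -> ray_class r = ray_class r' -> same_end r r'.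
  move=> rayr rayr' E; apply/ray_equivE => //.
  by move: (class_self _ rayr'); rewrite -E => -[].
have [r1 ray1 E1] : ends Gamma w1 by rewrite endsE; left.
have [r2 ray2 E2] : ends Gamma w2 by rewrite endsE; right.
exists r1, r2; split=> //.
  move=> same; apply: ne; rewrite -E1 -E2; apply/seteqP; split=> r [rayr /(ray_equivE _ rayr) sr];
    by split=> //; apply/ray_equivE => // T finT; rewrite -sr // same.
move=> r rayr; have : ends Gamma (ray_class r) by exists r.
by rewrite endsE => -[E|E]; [left|right]; apply: class_eq; rewrite // ?E1 ?E2.
Qed.

(** Beyond a finite initial segment the ray [r] stays in its [S]-side. A set [T]
that misses this side can therefore meet only the initial segment, and if a
connected set [F] contains that segment and is disjoint from [T], then all of
[F] reaches the end of [r] by going to the segment and then along [r]. *)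
Lemma far_set_side S r : is_ray r -> finite_set S ->
  exists2 F0, finite_set F0 & forall F T, F0 `<=` F -> connected_set F ->
    (forall v, F v -> ~ T v) -> (forall v, T v -> ~ side S r v) ->
    F `<=` side T r.
Proof.
move=> rayr finS; have [n rS] := ray_in_side rayr finS.
exists (r @` [set k | (k <= n)%N]).
  by apply: finite_image; exact: (finite_II n.+1).
move=> F T F0F conF FT TS v Fv.
have Frn : F (r n) by apply: F0F; exists n => /=.
apply: (side_linked (w := r n)); first exact: connected_set_linked conF FT Fv Frn.
by exists n; apply: ray_linked => // k nk /TS; apply; exact: rS.
Qed.

End Sides.

(** * Translates of finite sets and of ends *)

Section Actions.
Variables (G : groupType) (Gamma : graph) (a : graph_action G Gamma).
Implicit Types (S T F A : set Gamma) (g h : G) (x y z v : Gamma) (r : nat -> Gamma).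

Lemma actK g v : a g (a g^-1%g v) = v.
Proof. by rewrite -actM mulgV act1. Qed.

Lemma actVK g v : a g^-1%g (a g v) = v.
Proof. by rewrite -actM mulVg act1. Qed.

Lemma act_inj g : injective (a g).
Proof. exact: can_inj (actVK g). Qed.

Lemma act_ray g r : is_ray r -> is_ray (a g \o r).
Proof.
move=> [injr adjr]; split; first exact: inj_comp (@act_inj g) injr.
by move=> n /=; apply/act_adj.
Qed.

(** Translates are written as preimages: [a g @^-1` T] is g^-1 T, and membership
in it unfolds by computation. *)
Lemma linked_act g T x y :
  linked_minus (a g @^-1` T) x y <-> linked_minus T (a g x) (a g y).
Proof.
split=> [|gxy].
  elim=> [u v [uv Tu Tv]|u|u v w _ uv _ vw]; last exact: linked_trans uv vw.
  - by apply: rt_step; split=> //; apply/act_adj.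
  - exact: rt_refl.
rewrite -(actVK g x) -(actVK g y); elim: gxy => [u v [uv Tu Tv]|u|u v w _ uv _ vw].
- by apply: rt_step; split; [apply/act_adj|rewrite /preimage /= actK..].
- exact: rt_refl.
- exact: linked_trans uv vw.
Qed.

Lemma side_act g T r v : side (a g @^-1` T) r v <-> side T (a g \o r) (a g v).
Proof.
by split=> -[n vr]; exists n => k nk; apply/linked_act; exact: vr.
Qed.

Lemma finite_preimage_act g T : finite_set T -> finite_set (a g @^-1` T).
Proof. by apply: finite_preimage => x y _ _; exact: act_inj. Qed.

Lemma connected_preimage_act g T : connected_set T -> connected_set (a g @^-1` T).
Proof. by move=> conT x y Tx Ty; rewrite preimage_setC; apply/linked_act/conT. Qed.

Hypothesis free : almost_free a.

(** For given [x] and [s], the elements moving [x] to [s] form a coset of the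
stabilizer of [x], or no element does so. *)
Lemma finite_hits F S : finite_set F -> finite_set S ->
  finite_set [set g | exists2 x, F x & S (a g x)].
Proof.
move=> finF finS.
have sub : [set g | exists2 x, F x & S (a g x)] `<=`
    \bigcup_(x in F) \bigcup_(s in S) [set g | a g x = s].
  by move=> g [x Fx Sgx]; exists x => //; exists (a g x).
apply: sub_finite_set sub _; apply: bigcup_finite => // x _.
apply: bigcup_finite => // s _.
have [[g0 g0x]|none] := pselect (exists g, a g x = s); last first.
  suff -> : [set g | a g x = s] = set0 by [].
  by apply/seteqP; split=> // g gx; apply: none; exists g.
suff sub : [set g | a g x = s] `<=` [set (g0 * h)%g | h in stabilizer a x].
  by apply: sub_finite_set sub _; apply: finite_image; exact: free.
move=> g gx; exists (g0^-1 * g)%g; last by rewrite mulVKg.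
by rewrite /stabilizer /= actM gx -g0x actVK.
Qed.

Hypothesis orbits : finitely_many_orbits a.

Lemma finite_orbitwise A :
  (forall x, finite_set [set g | A (a g x)]) -> finite_set A.
Proof.
move=> finA.
have sub : A `<=` \bigcup_(O in range (orbit_of a)) (A `&` O).
  move=> v Av; exists (orbit_of a v); first by exists v.
  by split=> //; exists 1%g; rewrite ?act1.
apply: sub_finite_set sub _; apply: bigcup_finite => // _ [x _ <-].
have sub : A `&` orbit_of a x `<=` [set a g x | g in [set g | A (a g x)]].
  by move=> y [Ay [g _ gx]]; exists g => //=; rewrite gx.
by apply: sub_finite_set sub _; exact: finite_image.
Qed.

Lemma infinite_group r : is_ray r -> infinite_set [set: G].
Proof.
move=> [injr _] finG; apply: infinite_nat.
have -> : [set: nat] = r @^-1` [set: Gamma] by [].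
apply: finite_preimage => [x y _ _|]; first exact: injr.
by apply: finite_orbitwise => x; apply: sub_finite_set finG.
Qed.

(** If T cut off infinitely many vertices from both ends, almost freeness would
give a vertex [g x] among them for which g^-1 T is disjoint from a large finite
connected set [F] around [x] and [S]. Since g^-1 T is connected and avoids [S],
it misses one of the two [S]-sides, and then [x] reaches that end outside
g^-1 T. It does not matter whether [g] exchanges the two ends. *)
Lemma finite_sideless r1 r2 S T :
  connected_graph Gamma -> is_ray r1 -> is_ray r2 ->
  (forall r, is_ray r -> same_end r r1 \/ same_end r r2) ->
  finite_set S -> separates S r1 r2 ->
  finite_set T -> connected_set T ->
  finite_set [set v | ~ side T r1 v /\ ~ side T r2 v].
Proof.
move=> conG ray1 ray2 only2 finS sepS finT conT; apply: finite_orbitwise => x.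
have [F1 finF1 far1] := far_set_side ray1 finS.
have [F2 finF2 far2] := far_set_side ray2 finS.
have finF0 : finite_set (S `|` (F1 `|` F2)) by rewrite !finite_setU.
have [F [finF conF Fx F0F]] := finite_connected_hull x conG finF0.
apply: sub_finite_set (finite_hits finF finT) => g [out1 out2].
apply: contrapT => miss.
have FT v : F v -> ~ (a g @^-1` T) v by move=> Fv Tgv; apply: miss; exists v.
have in_side r : F `<=` side (a g @^-1` T) r -> side T (a g \o r) (a g x).
  by move=> /(_ _ Fx)/side_act.
have avoids : (forall v, T (a g v) -> ~ side S r1 v) \/
    (forall v, T (a g v) -> ~ side S r2 v).
  have [[u Tu u1]|none] := pselect (exists2 v, T (a g v) & side S r1 v); last first.
    by left=> v Tv v1; apply: none; exists v.
  right=> v Tv v2; apply: sepS u1 (side_linked _ v2).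
  apply: (connected_set_linked (connected_preimage_act (g := g) conT)) => // z Tz Sz.
  by apply: FT Tz; apply: F0F; left.
case: avoids => avoids.
- have /in_side : F `<=` side (a g @^-1` T) r1.
    by apply: far1 => // v F1v; apply: F0F; right; left.
  by case: (only2 _ (act_ray g ray1)) => ->.
- have /in_side : F `<=` side (a g @^-1` T) r2.
    by apply: far2 => // v F2v; apply: F0F; right; right.
  by case: (only2 _ (act_ray g ray2)) => ->.
Qed.

Lemma same_end_act g r r' : same_end (a g \o r) (a g \o r') -> same_end r r'.
Proof.
move=> same T finT; have finT' := finite_preimage_act g^-1%g finT.
have -> : T = a g @^-1` (a g^-1%g @^-1` T).
  by apply/seteqP; split=> v; rewrite /preimage /= actVK.
by apply/seteqP; split=> v /side_act vr; apply/side_act; rewrite (same, =^~ same).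
Qed.

(** The elements moving the end of [r1] form at most one coset of its stabilizer,
since they all take it to the end of [r2]; so a finite stabilizer would make the
group finite. *)
Lemma infinite_end_stabilizer r1 r2 :
  is_ray r1 -> is_ray r2 -> (forall r, is_ray r -> same_end r r1 \/ same_end r r2) ->
  infinite_set [set g | same_end (a g \o r1) r1].
Proof.
move=> ray1 ray2 only2 finfix; apply: (infinite_group ray1).
have [[g0 move0]|none] := pselect (exists g, ~ same_end (a g \o r1) r1); last first.
  apply: sub_finite_set finfix => g _ /=; apply: contrapT => ng.
  by apply: none; exists g.
have to2 g : ~ same_end (a g \o r1) r1 -> same_end (a g \o r1) r2.
  by case: (only2 _ (act_ray g ray1)).
have cover : [set: G] `<=` [set g | same_end (a g \o r1) r1] `|`
    [set (g0 * g)%g | g in [set g | same_end (a g \o r1) r1]].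
  move=> g _; have [fix_g|move_g] := pselect (same_end (a g \o r1) r1); first by left.
  right; exists (g0^-1 * g)%g; last by rewrite mulVKg.
  apply: (@same_end_act g0).
  have -> : a g0 \o (a (g0^-1 * g)%g \o r1) = a g \o r1.
    by apply/funext => n /=; rewrite -actM mulVKg.
  by move=> T finT; rewrite to2 // to2.
by apply: sub_finite_set cover _; rewrite finite_setU; split=> //; exact: finite_image.
Qed.

End Actions.

(** * Cyclic subgroups *)

Section Powers.
Variable G : groupType.
Implicit Types h : G.

Definition powers h : set G :=
  [set x | exists n, x = (h ^+ n)%g \/ x = (h ^- n)%g].

Lemma powersP h x : powers h x <-> exists m n, x = (h ^+ m * h ^- n)%g.
Proof.
split=> [[n [->|->]]|[m [n ->]]].
- by exists n, 0; rewrite expg0 invg1 mulg1.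
- by exists 0, n; rewrite expg0 mul1g.
case: (leqP n m) => [nm|/ltnW mn].
  by exists (m - n); left; rewrite expgnFr.
by exists (n - m); right; rewrite expgnFr // invgF.
Qed.

Lemma powers_subgroup h : is_subgroup (powers h).
Proof.
split.
- by exists 0; left.
- move=> _ _ /powersP[m [n ->]] /powersP[p [q ->]]; apply/powersP.
  exists (m + p), (q + n); rewrite !expgnDr invgM.
  rewrite -!mulgA; congr (_ * _)%g; rewrite !mulgA; congr (_ * _)%g.
  by apply/commute_sym/commuteV/commuteX2.
- move=> _ /powersP[m [n ->]]; apply/powersP; exists n, m.
  exact: invgF.
Qed.

End Powers.

(** * A translation that pushes a set with small boundary into itself *)

Section Translation.
Variables (G : groupType) (Gamma : graph) (a : graph_action G Gamma).
Implicit Types (S T F A : set Gamma) (g h : G) (x y z v : Gamma) (r : nat -> Gamma).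

(** [A] plays the role of a component of the complement of [S]: its boundary lies
in [S], outside [A]. The element [h] translates away from [A]: both h^-1 S and
h^-1 A lie in [A], so the sets h^m A form a chain increasing with m. *)
Section NestedSet.
Variables (h : G) (A S : set Gamma).
Hypothesis conG : connected_graph Gamma.
Hypothesis boundary : forall x y, adj x y -> A x -> ~ A y -> S y.
Hypothesis SA : forall x, S x -> ~ A x.
Hypothesis hS : forall x, S (a h x) -> A x.
Hypothesis hA : forall x, A (a h x) -> A x.
Variable s0 : Gamma.
Hypothesis Ss0 : S s0.

Let s1 := a h^-1%g s0.

Let As1 : A s1.
Proof. by apply: hS; rewrite actK. Qed.

Let hs1 : ~ A (a h s1).
Proof. by rewrite actK; exact: SA. Qed.

(** If x is in h^m A, then a neighbour y is either in h^m A or in its boundary,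
which is contained in h^m S and hence in h^(m+1) A. *)
Lemma reaches_nested v : exists m, A (a (h ^- m)%g v).
Proof.
move: v; apply: (connected_closed (v0 := s1)) => //.
  by exists 0; rewrite expg0 invg1 act1.
move=> x y xy [m Ax]; have [Ay|nAy] := pselect (A (a (h ^- m)%g y)); first by exists m.
exists m.+1; apply: hS; rewrite -actM expgSr invgM mulgA mulgV mul1g.
by apply: boundary _ Ax nAy; apply/act_adj.
Qed.

(** If x is outside h^-n A, then a neighbour y is outside h^-(n+1) A: otherwise x
would be in h^-(n+1) A or in h^-(n+1) S, and both are contained in h^-n A. *)
Lemma leaves_nested v : exists n, ~ A (a (h ^+ n)%g v).
Proof.
move: v; apply: (connected_closed (v0 := s1)) => //; first by exists 1; rewrite expg1.
move=> x y xy [n nAx]; exists n.+1 => Ay; apply: nAx.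
have [Ax|nAx] := pselect (A (a (h ^+ n.+1)%g x)).
  by apply: hA; rewrite -actM -expgS.
apply: hS; rewrite -actM -expgS.
by apply: boundary _ Ay nAx; apply/act_adj/adj_sym.
Qed.

(** [A] minus h^-1 A contains a representative of every orbit of the powers of
[h]: some translate of [v] is in [A], and pushing it forward by [h] there is a
last moment before it leaves. *)
Lemma meets_domain v : exists2 z, powers h z & A (a z v) /\ ~ A (a h (a z v)).
Proof.
have [m Am] := reaches_nested v; set w := a _ v in Am.
have [n nAn] := leaves_nested w.
suff [k [Ak nAk]] : exists k, A (a (h ^+ k)%g w) /\ ~ A (a (h ^+ k.+1)%g w).
  exists (h ^+ k * h ^- m)%g; first by apply/powersP; exists k, m.
  by rewrite !actM -/w; split=> //; rewrite -actM -expgS.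
elim: n nAn => [|n IHn] nAn; first by rewrite expg0 act1 in nAn.
by have [An|/IHn//] := pselect (A (a (h ^+ n)%g w)); exists n.
Qed.

(** Were h^(n+1) = 1, the point [s1] = h^-1 s0 would give a contradiction:
[a h s1] is outside [A], but applying [h] another n times returns to [s1],
which is in [A], and points outside [A] stay outside under [h]. *)
Lemma powers_infinite : infinite_set (powers h).
Proof.
have desc n x : A (a (h ^+ n)%g x) -> A x.
  elim: n => [|n IHn]; first by rewrite expg0 act1.
  by rewrite expgS actM => /hA.
have pos n : (h ^+ n.+1)%g <> 1%g.
  move=> h1; apply: hs1; apply: (desc n); rewrite -actM -expgSr h1 act1; exact: As1.
move=> finH; apply: infinite_nat.
have -> : [set: nat] = (fun n => (h ^+ n)%g) @^-1` powers h.
  by apply/seteqP; split=> // n _; exists n; left.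
apply: finite_preimage finH => m n _ _ /= E.
wlog mn : m n E / (m <= n)%N.
  by move=> wl; case/orP: (leq_total m n) => /wl -> //.
have := expgnFr h mn; rewrite E mulgV; case nm : (n - m) => [|k] => [_|/pos//].
by apply/eqP; rewrite eqn_leq mn /leq nm.
Qed.

(** Each coset u<h> contains some k for which k^-1 s0 is in the finite set [A]
minus h^-1 A, and almost freeness leaves only finitely many such k. *)
Lemma powers_finite_index : almost_free a ->
  finite_set [set v | A v /\ ~ A (a h v)] -> finite_index (powers h).
Proof.
move=> free finD; set D := [set v | _] in finD.
have finK : finite_set [set k | D (a k^-1%g s0)].
  have /(finite_image (fun g => g^-1%g)) : finite_set [set g | exists2 x, [set s0] x & D (a g x)].
    exact: finite_hits.
  apply: sub_finite_set => k Dk; exists k^-1%g; last exact: invgK.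
  by exists s0.
suff cover : range (left_coset (powers h)) `<=`
    [set left_coset (powers h) k | k in [set k | D (a k^-1%g s0)]].
  by apply: sub_finite_set cover _; exact: finite_image.
have [_ mulH invH] := powers_subgroup h.
move=> _ [u _ <-]; have [z Hz Dz] := meets_domain (a u^-1%g s0).
exists (u * z^-1)%g; first by rewrite /= invgF actM.
apply/seteqP; split=> _ [y Hy <-].
- by exists (z^-1 * y)%g; [apply: mulH => //; exact: invH|rewrite mulgA].
- by exists (z * y)%g; [exact: mulH|rewrite mulgA mulgVK].
Qed.

End NestedSet.

(** The case of the theorem in which a translate T = g^-1 S, with [g] fixing both
ends, lies on the second side of [S] while [S] lies on the first side of T. The
set pushed into itself is the second side of [S]. A vertex of it that is not on
the second side of T is on neither side of any connected set containing S and T,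
and only finitely many vertices are. *)
Lemma nested_sides_virtually_cyclic r1 r2 S g :
  connected_graph Gamma -> almost_free a -> is_ray r1 -> is_ray r2 ->
  (forall T, finite_set T -> connected_set T ->
     finite_set [set v | ~ side T r1 v /\ ~ side T r2 v]) ->
  finite_set S -> S !=set0 -> separates S r1 r2 ->
  same_end (a g \o r1) r1 -> same_end (a g \o r2) r2 ->
  a g @^-1` S `<=` side S r2 -> S `<=` side (a g @^-1` S) r1 ->
  exists H : set G,
    [/\ is_subgroup H, is_cyclic H, infinite_set H & finite_index H].
Proof.
move=> conG free ray1 ray2 sideless finS [s0 Ss0] sepS fix1 fix2 TS ST.
set T := a g @^-1` S in TS ST.
have finT : finite_set T by exact: finite_preimage_act.
have sideT1 v : side T r1 v <-> side S r1 (a g v) by rewrite -(fix1 S finS); exact: side_act.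
have sideT2 v : side T r2 v <-> side S r2 (a g v) by rewrite -(fix2 S finS); exact: side_act.
have T2S v : side T r2 v -> side S r2 v.
  by apply: side_avoid => z /sideT2 z2 /ST /sideT1 z1; exact: sepS z1 z2.
have boundary x y : adj x y -> side S r2 x -> ~ side S r2 y -> S y.
  move=> xy x2 ny; apply: contrapT => nSy; apply: ny; have nSx := side_outside ray2 x2.
  by apply: side_linked x2; apply: rt_step; split=> //; exact: adj_sym.
have outside x : S x -> ~ side S r2 x by move=> Sx /(side_outside ray2).
have pull x : side S r2 (a g x) -> side S r2 x by move/sideT2/T2S.
exists (powers g); split.
- exact: powers_subgroup.
- by exists g.
- exact: (powers_infinite outside TS pull Ss0).
apply: (powers_finite_index conG boundary outside TS pull Ss0 free).
have finST : finite_set (S `|` T) by rewrite finite_setU.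
have [U [finU conU _ STU]] := finite_connected_hull s0 conG finST.
apply: sub_finite_set (sideless U finU conU) => v [v2 nv2]; split=> [U1|U2].
- by apply: sepS v2; apply: side_subset U1 => x Sx; apply: STU; left.
- by apply/nv2/sideT2; apply: side_subset U2 => x Tx; apply: STU; right.
Qed.

End Translation.

Theorem theorem4p4 (G : groupType) (Gamma : graph) (a : graph_action G Gamma) :
  finitely_many_orbits a ->
  almost_free a ->
  connected_graph Gamma ->
  two_ended Gamma ->
  (forall w, ends Gamma w -> ~ dominated w) ->
  exists H : set G,
    [/\ is_subgroup H, is_cyclic H, infinite_set H & finite_index H].
Proof.
move=> orbits free conG two _.
have [r1 [r2 [ray1 ray2 diff only2]]] := two_ended_rays two.
have [S0 finS0 sepS0] := not_same_end_separates ray1 ray2 diff.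
have [S [finS conS Sr1 S0S]] := finite_connected_hull (r1 0) conG finS0.
have sepS : separates S r1 r2.
  by move=> v v1 v2; apply: sepS0 (side_subset S0S v1) (side_subset S0S v2).
have sideless T := finite_sideless free orbits conG ray1 ray2 only2 finS sepS (T := T).
have [F1 finF1 far1] := far_set_side ray1 finS.
have [F2 finF2 far2] := far_set_side ray2 finS.
have finF0 : finite_set (S `|` (F1 `|` F2)) by rewrite !finite_setU.
have [F [finF conF Fr1 F0F]] := finite_connected_hull (r1 0) conG finF0.
have [g fix1 miss] : exists2 g, same_end (a g \o r1) r1 & forall x, F x -> ~ S (a g x).
  apply: contrapT => none; apply: (infinite_end_stabilizer orbits ray1 ray2 only2).
  apply: sub_finite_set (finite_hits free finF finS) => g fix1.
  apply: contrapT => ng; apply: none; exists g => // x Fx Sgx.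
  by apply: ng; exists x.
have fix2 : same_end (a g \o r2) r2.
  have [same21|//] := only2 _ (act_ray a g ray2).
  by case: diff; apply: (@same_end_act _ _ a g) => T finT; rewrite fix1 // same21.
set T := a g @^-1` S.
have conT : connected_set T by exact: connected_preimage_act.
have SF : S `<=` F by move=> x Sx; apply: F0F; left.
(* [T] is connected and avoids [S], so it lies in one component off [S]. *)
have TS v w : T v -> T w -> linked_minus S v w.
  by move=> Tv Tw; apply: connected_set_linked conT _ Tv Tw => z Tz /SF /miss.
have toside1 : (forall v, T v -> ~ side S r1 v) -> F `<=` side T r1.
  by apply: far1 => // v F1v; apply: F0F; right; left.
have toside2 : (forall v, T v -> ~ side S r2 v) -> F `<=` side T r2.
  by apply: far2 => // v F2v; apply: F0F; right; right.
(* The situation is symmetric in the ends; the side of [S] where [T] lies decides. *)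
have [[u Tu u2]|none2] := pselect (exists2 u, T u & side S r2 u).
  have T2 : T `<=` side S r2 by move=> v Tv; exact: side_linked (TS _ _ Tv Tu) u2.
  have F1T : F `<=` side T r1 by apply: toside1 => v /T2 v2 v1; exact: sepS v1 v2.
  apply: (nested_sides_virtually_cyclic conG free ray1 ray2 sideless finS _ sepS fix1 fix2 T2).
    by exists (r1 0).
  by move=> v /SF /F1T.
have F2T : F `<=` side T r2 by apply: toside2 => v Tv v2; apply: none2; exists v.
have [[u Tu u1]|none1] := pselect (exists2 u, T u & side S r1 u).
  have T1 : T `<=` side S r1 by move=> v Tv; exact: side_linked (TS _ _ Tv Tu) u1.
  apply: (nested_sides_virtually_cyclic conG free ray2 ray1 _ finS _ _ fix2 fix1 T1).
  - move=> U finU conU; apply: sub_finite_set (sideless U finU conU) => v [n2 n1].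
    by split.
  - by exists (r1 0).
  - by move=> v v2 v1; exact: sepS v1 v2.
  - by move=> v /SF /F2T.
(* Missing both sides of [S], the set [T] would fail to separate the ends. *)
have F1T : F `<=` side T r1 by apply: toside1 => v Tv v1; apply: none1; exists v.
have /side_act := F1T _ Fr1; have /side_act := F2T _ Fr1.
by rewrite fix1 // fix2 // => v2 v1; case: (sepS _ v1 v2).
Qed.
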